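(* Let $I\subseteq\mathbb{R}_0$ be an interval, let $f:I\to\mathbb{R}$ be differentiable on $I^\circ$, let $a,b\in I$ with $a<b$, and let $f'\in L[a,b]$. Let $q\ge1$, $s\in(-1,1]$, $0\le\lambda,\mu\le1$, and suppose that $|f'(x)|^q$ is an extended $s$-convex function on $[a,b]$. Then $$\begin{aligned} &\left|\frac{\lambda f(a)+\mu f(b)}2+\frac{2-\lambda-\mu}2f\left(\frac{a+b}2\right)-\frac1{b-a}\int_a^bf(x)\,dx\right|\\ &\le\frac{b-a}4\left[\frac1{(s+1)(s+2)}\right]^{1/q}\Big\{\left(\tfrac12-\lambda+\lambda^2\right)^{1-1/q}\Big[\big(2(1-\lambda)^{s+2}+(s+2)\lambda-1\big)|f'(a)|^q\\ &\qquad+\big(2\lambda^{s+2}+s+1-(s+2)\lambda\big)\left|f'\left(\tfrac{a+b}2\right)\right|^q\Big]^{1/q}\\ &\quad+\left(\tfrac12-\mu+\mu^2\right)^{1-1/q}\Big[\big(2\mu^{s+2}+s+1-(s+2)\mu\big)\left|f'\left(\tfrac{a+b}2\right)\right|^q+\big(2(1-\mu)^{s+2}+(s+2)\mu-1\big)|f'(b)|^q\Big]^{1/q}\Big\}\\ &\le\frac{b-a}{2^{s/q+2}}\left[\frac1{(s+1)(s+2)}\right]^{1/q}\Big\{\left(\tfrac12-\lambda+\lambda^2\right)^{1-1/q}\Big[\big((1-\lambda)^{s+2}2^{s+1}+2\lambda^{s+2}+s+1+((s+2)\lambda-1)2^s-(s+2)\lambda\big)|f'(a)|^q\\ &\qquad+\big(2\lambda^{s+2}-(s+2)\lambda+s+1\big)|f'(b)|^q\Big]^{1/q}\\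 &\quad+\left(\tfrac12-\mu+\mu^2\right)^{1-1/q}\Big[\big(2\mu^{s+2}-(s+2)\mu+s+1\big)|f'(a)|^q\\ &\qquad+\big((1-\mu)^{s+2}2^{s+1}+2\mu^{s+2}+((s+2)\mu-1)2^s-(s+2)\mu+s+1\big)|f'(b)|^q\Big]^{1/q}\Big\}. \end{aligned}$$
   Context: $\mathbb{R}_0=[0,\infty)$; $I^\circ$ is the interior of the interval $I$; $L[a,b]$ is the set of Lebesgue integrable functions on $[a,b]$. For $s\in[-1,1]$, a function $g:J\to\mathbb{R}_0$ on an interval $J\subseteq\mathbb{R}_0$ is called extended $s$-convex if $g(tx+(1-t)y)\le t^sg(x)+(1-t)^sg(y)$ for all $x,y\in J$ and $t\in(0,1)$. The hypothesis on $|f'|^q$ presupposes that $f'$ exists on all of $[a,b]$; if $a$ or $b$ is an endpoint of $I$, the derivative there is one-sided. *)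

(* Defs.v *)
From HB Require Import structures.
From mathcomp Require Import all_boot all_order all_algebra.
From mathcomp Require Import all_classical all_reals all_analysis.

Set Implicit Arguments.
Unset Strict Implicit.
Unset Printing Implicit Defensive.

Import Order.TTheory GRing.Theory Num.Theory.
Import numFieldNormedType.Exports.

Local Open Scope classical_set_scope.
Local Open Scope ring_scope.

(* Derivative of [f : I -> R], a function being represented by a total one of
   which only the values on [I] matter: the increment [h] is restricted by
   [x + h \in I].  This is the usual derivative at interior points of [I] and
   the one-sided derivative at an endpoint belonging to [I]. *)
Definition diff_quot_in (R : realType) (I : set R) (f : R -> R) (x : R) :=
  h^-1 *: (f (h + x) - f x) @[h --> within [set h | I (h + x)] 0^'].

Definition derivable_in (R : realType) (I : set R) (f : R -> R) (x : R) : Prop :=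
  cvg (diff_quot_in I f x).

Definition derive_in (R : realType) (I : set R) (f : R -> R) (x : R) : R :=
  lim (diff_quot_in I f x).

Lemma diff_quot_in_interior (R : realType) (I : set R) (f : R -> R) (x : R) :
  I° x -> diff_quot_in I f x = (h^-1 *: (f (h + x) - f x) @[h --> 0^']).
Proof.
move=> Ix; rewrite /diff_quot_in; congr (_ @ _).
have nI : \forall h \near 0^', I (h + x).
  have : \forall h \near (0 : R), I (h + x).
    have c : (h + x) @[h --> (0 : R)] --> x.
      rewrite -[X in _ --> X]add0r.
      by apply: cvgD; [exact: cvg_id|exact: cvg_cst].
    exact: (c _ Ix).
  exact: nbhs_dnbhs.
apply/seteqP; split=> A; last exact: cvg_within.
by rewrite /within /= => wA; apply: filterS2 nI wA => h Ih; exact.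
Qed.

Lemma derivable_in_interior (R : realType) (I : set R) (f : R -> R) (x : R) :
  I° x -> derivable_in I f x <-> derivable f x 1.
Proof.
move=> Ix; rewrite /derivable_in diff_quot_in_interior// /derivable.
by under [X in cvg (X @ _)]eq_fun do rewrite -[X in f (X + _)]mulr1.
Qed.

Lemma derive_in_interior (R : realType) (I : set R) (f : R -> R) (x : R) :
  I° x -> derive_in I f x = derive1 f x.
Proof. by move=> Ix; rewrite /derive_in diff_quot_in_interior. Qed.

Definition extended_s_convex (R : realType) (s : R) (J : set R) (g : R -> R) : Prop :=
  [/\ -1 <= s <= 1,
      is_interval J,
      (forall x, J x -> 0 <= x),
      (forall x, J x -> 0 <= g x) &
      (forall x y t, J x -> J y -> 0 < t < 1 ->
        g (t * x + (1 - t) * y) <= t `^ s * g x + (1 - t) `^ s * g y)].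

(* Main.v *)
(* On each half [x, y] of [a, b], rescaled to [0, 1], the quantity to bound is
     t f(0) + (1 - t) f(1) - \int_0^1 f = \int_0^1 (u - t) f'(u) du.
   The tangent line of the concave function y |-> y^(1/q) at a point z > 0 turns
   |f'(u)|^q <= (1 - u)^s G0 + u^s G1 into |f'(u)| <= A + B u^s + C (1 - u)^s,
   whose first and second primitives are explicit.  Comparing increments of f,
   and then of a primitive of f, with these two primitives bounds the left-hand
   side by the integral of |u - t| (A + B u^s + C (1 - u)^s) without integrating
   f'.  With W = \int |u - t| = 1/2 - t + t^2 and
   Y = \int |u - t| ((1 - u)^s G0 + u^s G1), the choice z = Y / W
   (z -> 0 if Y = 0) gives W^(1 - 1/q) Y^(1/q), the bound that Hoelder's
   inequality would give.  The second inequality is s-convexity at the midpoint: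
   2^s g(m) <= g(a) + g(b) with g = |f'|^q. *)
Require Import Defs.
From HB Require Import structures.
From mathcomp Require Import all_boot all_order all_algebra.
From mathcomp Require Import all_classical all_reals all_analysis.
From mathcomp Require Import ring lra.

Set Implicit Arguments.
Unset Strict Implicit.
Unset Printing Implicit Defensive.

Import Order.TTheory GRing.Theory Num.Theory.
Import numFieldNormedType.Exports.

Local Open Scope classical_set_scope.
Local Open Scope ring_scope.

(** * Continuity relative to a set *)

Lemma within_continuous_precomp (T U V : topologicalType) (A : set T)
    (B : set U) (f : U -> V) (g : T -> U) :
  continuous g -> {homo g : x / A x >-> B x} ->
  {within B, continuous f} -> {within A, continuous (f \o g)}.
Proof.
move=> cg gAB /subspace_continuousP cf; apply/subspace_continuousP => x Ax.
move=> P nP.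
have nBP : \forall y \near g x, B y -> P (f y) := cf _ (gAB _ Ax) _ nP.
have : \forall z \near x, B (g z) -> P (f (g z)) := cg x _ nBP.
by apply: (filterS _) => z /= BP /gAB /BP.
Qed.

Lemma within_continuous_powR (R : realType) (p : R) : 0 < p ->
  {within `[0, 1], continuous (fun x : R => x `^ p)}.
Proof.
move=> p0; have cp (x : R) : 0 < x -> {for x, continuous (fun x : R => x `^ p)}.
  move=> x0; apply/differentiable_continuous/derivable1_diffP.
  by apply: derivable_powR; rewrite in_itv/= x0.
apply/continuous_within_itvP => //; split.
- by move=> x; rewrite in_itv/= => /andP[x0 _]; exact: cp.
(* At the endpoint 0 the limit agrees with the value because 0^p = 0 for p > 0. *)
- by rewrite powR0 ?gt_eqF//; exact: powR_cvg0.
- by apply: cvg_at_left_filter; exact: cp.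
Qed.

(** The increment of [f] is [h] times the difference quotient, a product of something tending to 0
    and something convergent. *)
Lemma derivable_in_continuous (R : realType) (I : set R) (f : R -> R) x :
  I x -> derivable_in I f x -> f @ within I (nbhs x) --> f x.
Proof.
move=> Ix dfx; set J := [set h | I (h + x)].
have h0 : h @[h --> within J 0^'] --> (0 : R).
  by move=> P nP; apply: cvg_within; apply: nbhs_dnbhs.
have := cvgD (cvgM h0 dfx) (cvg_cst (f x)); rewrite mul0r add0r => cf U fU.
have FJ : Filter (within J 0^') by exact: within_filter.
have {}cf := cf FJ FJ FJ.
have {}cf : \forall h \near 0^', J h ->
    U (h * (h^-1 *: (f (h + x) - f x)) + f x) := cf _ fU.
have {}cf : \forall h \near (0 : R), J h -> U (f (h + x)).
  have : \forall h \near (0 : R), h != 0 -> J h ->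
    U (h * (h^-1 *: (f (h + x) - f x)) + f x) := cf.
  (* The difference quotient lives on a punctured neighbourhood; the value [h = 0] is put back,
     since [f x] itself lies in [U]. *)
  apply: (filterS _) => h Uh Jh; have [->|h0'] := eqVneq h 0.
    by rewrite add0r; exact: nbhs_singleton.
  by have := Uh h0' Jh; rewrite /GRing.scale/= mulrA divff// mul1r subrK.
have : \forall y \near x, J (y - x) -> U (f (y - x + x)).
  have c : y - x @[y --> x] --> (0 : R).
    rewrite -[X in _ --> X](subrr x).
    by apply: cvgB; [exact: cvg_id|exact: cvg_cst].
  exact: c _ cf.
by apply: (filterS _) => y; rewrite /J /= subrK.
Qed.

(** * Comparison of increments *)

(** Both [g + f] and [g - f] have a nonnegative derivative, hence are nondecreasing. This replaces
    the estimate of an integral of [df] by one of [dg]. *)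
Lemma ler_dist_increment (R : realType) (a b : R) (f g df dg : R -> R) :
  {within `[a, b], continuous f} -> {within `[a, b], continuous g} ->
  {in `]a, b[, forall x : R, is_derive x 1 f (df x)} ->
  {in `]a, b[, forall x : R, is_derive x 1 g (dg x)} ->
  {in `]a, b[, forall x, `|df x| <= dg x} ->
  forall x y, a <= x -> x <= y -> y <= b -> `|f y - f x| <= g y - g x.
Proof.
move=> cf cg f' g' fg x y ax xy yb.
have xI : x \in `[a, b] by rewrite in_itv/= ax (le_trans xy).
have yI : y \in `[a, b] by rewrite in_itv/= yb (le_trans ax).
rewrite ler_norml; apply/andP; split.
- suff : (g + f) x <= (g + f) y by rewrite /= !fctE; lra.
  apply: (@ger0_derive1_le_cc _ _ a b) => //.
  + by move=> z zab; have [] := is_deriveD (g' z zab) (f' z zab).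
  + move=> z zab; rewrite derive1E; have [_ ->] := is_deriveD (g' z zab) (f' z zab).
    by have := fg z zab; rewrite ler_norml; lra.
  + by move=> z; apply: continuousD; [exact: cg|exact: cf].
- suff : (g - f) x <= (g - f) y by rewrite /= !fctE; lra.
  apply: (@ger0_derive1_le_cc _ _ a b) => //.
  + by move=> z zab; have [] := is_deriveB (g' z zab) (f' z zab).
  + move=> z zab; rewrite derive1E; have [_ ->] := is_deriveB (g' z zab) (f' z zab).
    by have := fg z zab; rewrite ler_norml; lra.
  + by move=> z; apply: continuousD; [exact: cg|exact/continuousN/cf].
Qed.

(** * Bernoulli's inequality and tangent lines of roots *)

(** For p > 1 this is Young's inequality for the product x * 1 with conjugate exponents p and p / (p
    - 1), multiplied by p. *)
Lemma powR_bernoulli (R : realType) (x p : R) :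
  0 <= x -> 1 <= p -> 1 + p * (x - 1) <= x `^ p.
Proof.
move=> x0; rewrite le_eqVlt => /predU1P[<-|p1]; first by rewrite powRr1//; lra.
have p0 : 0 < p by lra.
have p10 : 0 < p - 1 by lra.
have := @conjugate_powR R x 1 p (p / (p - 1)) x0 ler01 p0.
rewrite powR1 mulr1 divr_gt0// => /(_ isT).
have -> : p^-1 + (p / (p - 1))^-1 = 1 by field; rewrite !gt_eqF.
move=> /(_ erefl); rewrite -(ler_pM2l p0) mulrDr.
have -> : p * (x `^ p / p) = x `^ p by field; rewrite gt_eqF.
have -> : p * (1 / (p / (p - 1))) = p - 1 by field; rewrite !gt_eqF.
lra.
Qed.

Lemma powR_inv_bernoulli (R : realType) (x q : R) :
  0 <= x -> 1 <= q -> x `^ q^-1 <= 1 + (x - 1) / q.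
Proof.
move=> x0 q1; have q0 : 0 < q by lra.
have := powR_bernoulli (powR_ge0 x q^-1) q1.
rewrite -powRrM mulVf ?gt_eqF// powRr1// => h.
by rewrite -lerBlDl ler_pdivlMr//; lra.
Qed.

(** By homogeneity, the tangent at 1 evaluated at y / z and scaled by z^(1/q) is the tangent at
    z. *)
Lemma powR_inv_tangent (R : realType) (y z q : R) : 0 <= y -> 0 < z -> 1 <= q ->
  y `^ q^-1 <= z `^ q^-1 + z `^ q^-1 / (q * z) * (y - z).
Proof.
move=> y0 z0 q1; have yz : 0 <= y / z by rewrite divr_ge0// ltW.
have := powR_inv_bernoulli yz q1; rewrite -(ler_pM2l (powR_gt0 q^-1 z0)).
rewrite -powRM ?(ltW z0)// (mulrC z) divfK ?gt_eqF//.
have -> // : z `^ q^-1 * (1 + (y / z - 1) / q) =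
  z `^ q^-1 + z `^ q^-1 / (q * z) * (y - z).
by field; rewrite !gt_eqF//; lra.
Qed.

(** * Bounding a weighted mean by means of two successive primitives *)

Lemma is_derive_subZ (R : realType) (F : R -> R) (x d k : R) :
  is_derive x 1 F d -> is_derive x 1 (fun x => F x - k * x) (d - k).
Proof.
move=> dF.
apply: (is_derive_eq (is_deriveB dF (is_deriveZ k (is_derive_id x (1 : R))))).
by rewrite /GRing.scale/= mulr1.
Qed.

Lemma within_continuous_subZ (R : realType) (A : set R) (F : R -> R) (k : R) :
  {within A, continuous F} -> {within A, continuous (fun x => F x - k * x)}.
Proof.
move=> cF; have -> : (fun x => F x - k * x) = F - k *: id by [].
move=> x; apply: continuousD; first exact: cF.
apply/continuousN/continuous_subspaceT => y.
exact: mulrl_continuous.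
Qed.

(* The right-hand side is the integral of [`|x - c| * dg x] over [a, b],
   integrated by parts. *)
Lemma weighted_mean_dist_le (R : realType) (a b c : R)
    (f F df g G dg : R -> R) : a <= c <= b ->
  {within `[a, b], continuous f} -> {within `[a, b], continuous F} ->
  {within `[a, b], continuous g} -> {within `[a, b], continuous G} ->
  {in `]a, b[, forall x : R, is_derive x 1 f (df x)} ->
  {in `]a, b[, forall x : R, is_derive x 1 F (f x)} ->
  {in `]a, b[, forall x : R, is_derive x 1 g (dg x)} ->
  {in `]a, b[, forall x : R, is_derive x 1 G (g x)} ->
  {in `]a, b[, forall x, `|df x| <= dg x} ->
  `|(c - a) * f a + (b - c) * f b - (F b - F a)| <=
  (b - c) * g b - (c - a) * g a + 2 * G c - G a - G b.
Proof.
move=> /andP[ac cb] cf cF cg cG f' F' g' G' fg.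
have ab : a <= b := le_trans ac cb.
have fgle := ler_dist_increment cf cg f' g' fg.
(* Second use of the increment comparison: [F x - f a * x] has derivative [f x - f a], dominated by
   [g x - g a]. *)
have left_part : `|(F c - F a) - (c - a) * f a| <= G c - G a - (c - a) * g a.
  have := @ler_dist_increment _ a b (fun x => F x - f a * x)
    (fun x => G x - g a * x) (fun x => f x - f a) (fun x => g x - g a)
    (within_continuous_subZ cF) (within_continuous_subZ cG)
    (fun x xab => is_derive_subZ _ (F' x xab))
    (fun x xab => is_derive_subZ _ (G' x xab)) _ a c (lexx a) ac cb.
  have -> : F c - f a * c - (F a - f a * a) = F c - F a - (c - a) * f a by ring.
  have -> : G c - g a * c - (G a - g a * a) = G c - G a - (c - a) * g a by ring.
  by apply => x /[!in_itv]/= /andP[/ltW ax /ltW xb]; exact: fgle.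
(* Increments are now measured from [b]: [f x - f b] is dominated by [g b - g x], the derivative of
   [g b * x - G x]. *)
have right_part : `|(b - c) * f b - (F b - F c)| <= (b - c) * g b - (G b - G c).
  have := @ler_dist_increment _ a b (fun x => F x - f b * x)
    (fun x => (- G) x - (- g b) * x) (fun x => f x - f b) (fun x => - g x - - g b)
    (within_continuous_subZ cF) (within_continuous_subZ _)
    (fun x xab => is_derive_subZ _ (F' x xab))
    (fun x xab => is_derive_subZ _ (is_deriveN (G' x xab))) _ c b ac cb (lexx b).
  have -> : F b - f b * b - (F c - f b * c) = - ((b - c) * f b - (F b - F c))
    by ring.
  rewrite normrN /= !fctE.
  have -> : - G b - - g b * b - (- G c - - g b * c) = (b - c) * g b - (G b - G c)
    by ring.
  apply; first by move=> x; exact/continuousN/cG.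
  move=> x /[!in_itv]/= /andP[/ltW ax /ltW xb].
  by rewrite distrC; have := fgle x b ax xb (lexx b); lra.
have -> : (c - a) * f a + (b - c) * f b - (F b - F a) =
  ((b - c) * f b - (F b - F c)) - ((F c - F a) - (c - a) * f a) by ring.
apply: le_trans (ler_normB _ _) _.
apply: le_trans (lerD right_part left_part) _; lra.
Qed.

(** * Explicit primitives on the unit interval *)

(** Both primitives of A + B u^s + C (1 - u)^s have this shape, with [P] a monomial and p equal to s
    + 1 or s + 2. *)
Lemma is_derive_add_powR (R : realType) (P : R -> R) (x dP b c p : R) :
  0 < x < 1 -> is_derive x 1 P dP ->
  is_derive x 1 (fun u => P u + b * u `^ p + c * (1 - u) `^ p)
    (dP + b * p * x `^ (p - 1) - c * p * (1 - x) `^ (p - 1)).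
Proof.
move=> /andP[x0 x1] P'.
have x10 : 0 < 1 - x by lra.
have dr : is_derive x 1 (fun u : R => 1 - u) (- 1).
  apply: (is_derive_eq (is_deriveB (is_derive_cst (1 : R) x (1 : R))
    (is_derive_id x (1 : R)))).
  exact: sub0r.
have dl := is_derive1_powR p x0.
have d1 := @is_derive1_comp _ (@powR R ^~ p) _ x _ _ (is_derive1_powR p x10) dr.
apply: (is_derive_eq (is_deriveD (is_deriveD P' (is_deriveZ b dl))
  (is_deriveZ c d1))).
by rewrite /GRing.scale/=; ring.
Qed.

Lemma within_continuous_add_powR (R : realType) (P : R -> R) (b c p : R) :
  0 < p -> {within `[0, 1], continuous P} ->
  {within `[0, 1], continuous (fun u => P u + b * u `^ p + c * (1 - u) `^ p)}.
Proof.
move=> p0 cP.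
have cp := @within_continuous_powR R p p0.
have c1 : {within `[0, 1], continuous ((fun u : R => u `^ p) \o (fun u => 1 - u))}.
  apply: within_continuous_precomp cp.
    by move=> u; apply: cvgB; [exact: cvg_cst|exact: cvg_id].
  by move=> u /=; rewrite !in_itv/=; lra.
have -> : (fun u => P u + b * u `^ p + c * (1 - u) `^ p) =
  P + cst b * (@powR R ^~ p) + cst c * ((@powR R ^~ p) \o (fun u => 1 - u)) by [].
move=> x; apply: continuousD; [apply: continuousD|].
- exact: cP.
- by apply: continuousM; [exact: cst_continuous|exact: cp].
- by apply: continuousM; [exact: cst_continuous|exact: c1].
Qed.

Lemma weighted_mean_dist_le_powR (R : realType) (f F df : R -> R)
    (A B C s t : R) : -1 < s -> 0 <= t <= 1 ->
  {within `[0, 1], continuous f} -> {within `[0, 1], continuous F} ->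
  {in `]0, 1[, forall x : R, is_derive x 1 f (df x)} ->
  {in `]0, 1[, forall x : R, is_derive x 1 F (f x)} ->
  {in `]0, 1[, forall x, `|df x| <= A + B * x `^ s + C * (1 - x) `^ s} ->
  `|t * f 0 + (1 - t) * f 1 - (F 1 - F 0)| <=
  A * (2^-1 - t + t ^+ 2)
  + (B * (2 * t `^ (s + 2) + s + 1 - (s + 2) * t)
     + C * (2 * (1 - t) `^ (s + 2) + (s + 2) * t - 1)) / ((s + 1) * (s + 2)).
Proof.
move=> s1 t01 cf cF f' F' fle.
(* [g] is a primitive of the bound on [df] and [G] one of [g]. The sign before [C] comes from the
   inner derivative of 1 - u and disappears at the second integration. *)
pose g u : R := A * u + B / (s + 1) * u `^ (s + 1)
  + - C / (s + 1) * (1 - u) `^ (s + 1).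
pose G u : R := A / 2 * u ^+ 2 + B / ((s + 1) * (s + 2)) * u `^ (s + 2)
  + C / ((s + 1) * (s + 2)) * (1 - u) `^ (s + 2).
have s10 : s + 1 != 0 by rewrite gt_eqF//; lra.
have s20 : s + 2 != 0 by rewrite gt_eqF//; lra.
have cg : {within `[0, 1], continuous g}.
  (* Here s > -1 gives the positive exponent s + 1, so [g] is continuous up to the endpoints even
     when x^s is unbounded near 0. *)
  apply: within_continuous_add_powR; first lra.
  by apply: continuous_subspaceT => u; exact: mulrl_continuous.
have cG : {within `[0, 1], continuous G}.
  apply: within_continuous_add_powR; first lra.
  apply: continuous_subspaceT => u.
  by apply: cvgM; [exact: cvg_cst|exact: exprn_continuous].
have g' : {in `]0, 1[, forall x : R,
    is_derive x 1 g (A + B * x `^ s + C * (1 - x) `^ s)}.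
  move=> x; rewrite in_itv/= => x01.
  have dP : is_derive x 1 (fun u : R => A * u) A.
    apply: (is_derive_eq (is_deriveZ A (is_derive_id x (1 : R)))).
    by rewrite /GRing.scale/= mulr1.
  apply: (is_derive_eq (is_derive_add_powR _ _ _ x01 dP)).
  by rewrite addrK; field.
have G' : {in `]0, 1[, forall x : R, is_derive x 1 G (g x)}.
  move=> x; rewrite in_itv/= => x01.
  have dP : is_derive x 1 (fun u : R => A / 2 * u ^+ 2) (A * x).
    rewrite -[X in is_derive _ _ X]/((A / 2) *: (id ^+ 2)).
    apply: (is_derive_eq (is_deriveZ (A / 2)
      (is_deriveX 2 (is_derive_id x (1 : R))))).
    by rewrite /GRing.scale/=; field.
  apply: (is_derive_eq (is_derive_add_powR _ _ _ x01 dP)).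
  have -> : s + 2 - 1 = s + 1 by ring.
  by rewrite /g; field; rewrite s10.
have := weighted_mean_dist_le t01 cf cF cg cG f' F' g' G' fle.
rewrite /g /G subrr subr0 !powR1 !powR0// subr0 !powR1 => /le_trans; apply.
rewrite le_eqVlt; apply/orP; left; apply/eqP.
by field; rewrite s20 s10.
Qed.

(** * The Hoelder-type bound on the unit interval *)

(** Bernoulli with exponent s + 2 >= 1 makes one copy of t^(s+2) absorb the linear part; the other
    copy is nonnegative. *)
Lemma powR_s2_weight_ge0 (R : realType) (s t : R) : -1 <= s -> 0 <= t ->
  0 <= 2 * t `^ (s + 2) + s + 1 - (s + 2) * t.
Proof.
move=> s1 t0; have := powR_ge0 t (s + 2).
by have := @powR_bernoulli _ t (s + 2) t0; lra.
Qed.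

Lemma weighted_mean_dist_le_holder (R : realType) (f F df : R -> R)
    (G0 G1 q s t : R) :
  1 <= q -> -1 < s -> 0 <= t <= 1 -> 0 <= G0 -> 0 <= G1 ->
  {within `[0, 1], continuous f} -> {within `[0, 1], continuous F} ->
  {in `]0, 1[, forall x : R, is_derive x 1 f (df x)} ->
  {in `]0, 1[, forall x : R, is_derive x 1 F (f x)} ->
  {in `]0, 1[, forall x : R,
    `|df x| `^ q <= (1 - x) `^ s * G0 + x `^ s * G1} ->
  `|t * f 0 + (1 - t) * f 1 - (F 1 - F 0)| <=
  ((s + 1) * (s + 2))^-1 `^ q^-1 *
  ((2^-1 - t + t ^+ 2) `^ (1 - q^-1) *
   ((2 * (1 - t) `^ (s + 2) + (s + 2) * t - 1) * G0
    + (2 * t `^ (s + 2) + s + 1 - (s + 2) * t) * G1) `^ q^-1).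
Proof.
move=> q1 s1 t01 G00 G10 cf cF f' F' fle.
set P0 := _ - 1; set P1 := 2 * t `^ _ + _ + _ - _; set W := 2^-1 - t + _.
set S := P0 * _ + _; set D := _^-1.
have q0 : 0 < q by lra.
have P1ge0 : 0 <= P1 by apply: powR_s2_weight_ge0; lra.
have P0ge0 : 0 <= P0.
  (* [P0] is [P1] with t replaced by 1 - t. *)
  by have := @powR_s2_weight_ge0 _ s (1 - t); rewrite /P0; lra.
have Sge0 : 0 <= S by rewrite addr_ge0// mulr_ge0.
(* W = (t - 1/2)^2 + 1/4. *)
have W0 : 0 < W by rewrite /W; have := sqr_ge0 (t - 2^-1); lra.
have W1 : W <= 1 by rewrite /W; nra.
have D0 : 0 < D by rewrite invr_gt0 mulr_gt0//; lra.
(* The tangent at z is (r - k z) + k y with r = z^(1/q) and slope k. Its constant term gets the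
   weight W, and y contributes Y = [S * D]. *)
have bound z : 0 < z -> `|t * f 0 + (1 - t) * f 1 - (F 1 - F 0)| <=
    z `^ q^-1 * W + z `^ q^-1 / (q * z) * (S * D - z * W).
  move=> z0; set r := z `^ q^-1; set k := r / (q * z).
  have := @weighted_mean_dist_le_powR _ f F df (r - k * z) (k * G1) (k * G0)
    s t s1 t01 cf cF f' F'.
  rewrite -/W -/P0 -/P1 -/D => H; apply: le_trans (H _) _; last first.
    by rewrite le_eqVlt; apply/orP; left; apply/eqP; rewrite /S; ring.
  move=> x x01; have := fle x x01; set y := _ + x `^ s * _ => le_y.
  have y0 : 0 <= y by rewrite addr_ge0// mulr_ge0// powR_ge0.
  have -> : `|df x| = (`|df x| `^ q) `^ q^-1.
    by rewrite -powRrM mulfV ?gt_eqF// powRr1.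
  apply: (@le_trans _ _ (y `^ q^-1)).
    by apply: ge0_ler_powR; rewrite ?nnegrE ?powR_ge0// invr_ge0 ltW.
  apply: le_trans (powR_inv_tangent y0 z0 q1) _.
  rewrite -/r -/k le_eqVlt; apply/orP; left; apply/eqP; rewrite /y; ring.
have [S0|Sneq0] := eqVneq S 0.
  rewrite [leRHS](_ : _ = 0); last first.
    by rewrite S0 powR0 ?mulr0// invr_eq0 gt_eqF.
  (* The optimal z would be 0, which is not allowed. With z = e^q the bound is e W (1 - 1/q), at
     most e. *)
  apply/ler_addgt0Pr => e e0; rewrite add0r.
  have eq0 : 0 < e `^ q := powR_gt0 q e0.
  apply: le_trans (bound _ eq0) _.
  rewrite S0 -powRrM mulfV ?gt_eqF// (powRr1 (ltW e0)).
  have -> : e * W + e / (q * e `^ q) * (0 * D - e `^ q * W)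
      = e * (W * (1 - q^-1)) by field; rewrite !gt_eqF.
  rewrite -[leRHS]mulr1 ler_pM2l// -[leRHS]mulr1 ler_pM ?(ltW W0)//.
    by rewrite subr_ge0 invf_le1.
  by rewrite gerBl invr_ge0 ltW.
have S0 : 0 < S by rewrite lt_def Sneq0.
(* At z = Y / W the linear correction vanishes, leaving z^(1/q) W = W^(1 - 1/q) Y^(1/q). *)
have z0 : 0 < S * D / W by rewrite divr_gt0// mulr_gt0.
apply: le_trans (bound _ z0) _.
rewrite divfK ?gt_eqF// subrr mulr0 addr0 le_eqVlt; apply/orP; left; apply/eqP.
rewrite (powRM _ (mulr_ge0 Sge0 (ltW D0))) ?invr_ge0 ?(ltW W0)//.
rewrite powRM// ?(ltW D0)// powRB ?(gt_eqF W0) ?implybT// (powRr1 (ltW W0)).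
by rewrite -[W^-1]powR_inv1 ?(ltW W0)// powRAC powR_inv1 ?powR_ge0//; ring.
Qed.

(** * Rescaling to an arbitrary interval *)

Lemma is_derive_affine_comp (R : realType) (f : R -> R) (c x h u d : R) :
  is_derive (x + u * h) 1 f d ->
  is_derive u 1 (fun u => c * f (x + u * h)) (c * (d * h)).
Proof.
move=> df; have da : is_derive u 1 (fun u : R => x + u * h) h.
  apply: (is_derive_eq (is_deriveD (is_derive_cst x u (1 : R))
    (is_deriveM (is_derive_id u (1 : R)) (is_derive_cst h u (1 : R))))).
  by rewrite /GRing.scale/=; ring.
have dc := @is_derive1_comp _ f (fun u => x + u * h) u _ _ df da.
exact: (is_derive_eq (is_deriveZ c dc)).
Qed.

Lemma within_continuous_affine_comp (R : realType) (f : R -> R) (c x y : R) :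
  x <= y -> {within `[x, y], continuous f} ->
  {within `[0, 1], continuous (fun u => c * f (x + u * (y - x)))}.
Proof.
move=> xy cf.
have cfa : {within `[0, 1], continuous (f \o (fun u => x + u * (y - x)))}.
  apply: within_continuous_precomp cf.
    move=> u; apply: cvgD; first exact: cvg_cst.
    by apply: cvgM; [exact: cvg_id|exact: cvg_cst].
  by move=> u /=; rewrite !in_itv/=; nra.
have -> : (fun u => c * f (x + u * (y - x))) =
  cst c * (f \o (fun u => x + u * (y - x))) by [].
by move=> u; apply: continuousM; [exact: cst_continuous|exact: cfa].
Qed.

Lemma weighted_mean_dist_le_itv (R : realType) (f F df : R -> R)
    (x y G0 G1 q s t : R) : x < y ->
  1 <= q -> -1 < s -> 0 <= t <= 1 -> 0 <= G0 -> 0 <= G1 ->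
  {within `[x, y], continuous f} -> {within `[x, y], continuous F} ->
  {in `]x, y[, forall v : R, is_derive v 1 f (df v)} ->
  {in `]x, y[, forall v : R, is_derive v 1 F (f v)} ->
  {in `]0, 1[, forall u : R,
    `|df (x + u * (y - x))| `^ q <= (1 - u) `^ s * G0 + u `^ s * G1} ->
  `|t * f x + (1 - t) * f y - (F y - F x) / (y - x)| <=
  (y - x) * (((s + 1) * (s + 2))^-1 `^ q^-1 *
  ((2^-1 - t + t ^+ 2) `^ (1 - q^-1) *
   ((2 * (1 - t) `^ (s + 2) + (s + 2) * t - 1) * G0
    + (2 * t `^ (s + 2) + s + 1 - (s + 2) * t) * G1) `^ q^-1)).
Proof.
move=> xy q1 s1 t01 G00 G10 cf cF f' F' fle.
have xyW := ltW xy; have h0 : 0 < y - x by lra.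
have h0' : y - x != 0 by rewrite gt_eqF.
have uI (u : R) : u \in `]0, 1[ -> x + u * (y - x) \in `]x, y[.
  by rewrite !in_itv/=; nra.
(* Dividing by y - x once for [f] and twice for [F] cancels the chain-rule factors: [f1] has
   derivative exactly [df] at the rescaled point, and [F1] is a primitive of [f1]. *)
pose f1 u := (y - x)^-1 * f (x + u * (y - x)).
pose F1 u := ((y - x)^-1 * (y - x)^-1) * F (x + u * (y - x)).
have f1' : {in `]0, 1[, forall u : R, is_derive u 1 f1 (df (x + u * (y - x)))}.
  move=> u /uI xu.
  apply: (is_derive_eq (is_derive_affine_comp _ (f' _ xu))).
  by field.
have F1' : {in `]0, 1[, forall u : R, is_derive u 1 F1 (f1 u)}.
  move=> u /uI xu.
  apply: (is_derive_eq (is_derive_affine_comp _ (F' _ xu))).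
  by rewrite /f1; field.
have := @weighted_mean_dist_le_holder R f1 F1 _ G0 G1 q s t q1 s1 t01 G00 G10
  (within_continuous_affine_comp xyW cf)
  (within_continuous_affine_comp xyW cF) f1' F1' fle.
rewrite -(ler_pM2l h0) /f1 /F1 mul0r mul1r addr0 subrKC; apply: le_trans.
rewrite -[X in _ <= X * _](gtr0_norm h0) -normrM.
rewrite le_eqVlt; apply/orP; left; apply/eqP.
by congr (`|_|); field.
Qed.

(** * Regularity of the function and of its integral *)

Lemma within_continuous_derivable_in (R : realType) (I A : set R) (f : R -> R) :
  A `<=` I -> (forall x, A x -> derivable_in I f x) ->
  {within A, continuous f}.
Proof.
move=> AI df; apply/subspace_continuousP => x Ax.
move=> P nP; have IP : \forall y \near x, I y -> P (f y) :=
  derivable_in_continuous (AI _ Ax) (df _ Ax) nP.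
have : \forall y \near x, A y -> P (f y).
  by apply: (filterS _) IP => y IP /AI.
exact.
Qed.

Lemma is_derive_derive_in (R : realType) (I : set R) (f : R -> R) (x : R) :
  I° x -> derivable_in I f x -> is_derive x 1 f (derive_in I f x).
Proof.
move=> Ix dfx; have fx := (derivable_in_interior f Ix).1 dfx.
by apply: DeriveDef => //; rewrite -derive1E derive_in_interior.
Qed.

Lemma interval_itvoo_interior (R : realType) (I : set R) (a b : R) :
  is_interval I -> I a -> I b -> `]a, b[ `<=` I°.
Proof.
move=> II Ia Ib x xab; have : \forall y \near x, y \in `]a, b[.
  exact: near_in_itvoo.
apply: (filterS _) => y; rewrite in_itv/= => /andP[/ltW ay /ltW yb].
by apply: II Ia Ib _ _; rewrite ay.
Qed.

Lemma continuous_Rintegral_primitive (R : realType) (f : R -> R) (a b : R) :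
  a < b -> {within `[a, b], continuous f} ->
  let F := fun x => \int[lebesgue_measure]_(t in `[a, x]) f t in
  {within `[a, b], continuous F} /\
  {in `]a, b[, forall x : R, is_derive x 1 F (f x)}.
Proof.
move=> ab cf F.
have intf : lebesgue_measure.-integrable `[a, b] (EFin \o f).
  by apply: continuous_compact_integrable => //; exact: segment_compact.
split; first by apply: parameterized_integral_continuous => //; exact: ltW.
move=> x xab; have cfx := within_continuous_continuous ab cf xab.
move: xab; rewrite in_itv/= => /andP[ax xb].
have [dF <-] := continuous_FTC1_closed xb intf ax cfx.
by rewrite derive1E; exact/derivableP.
Qed.

(** * Joining the two halves and eliminating the midpoint *)

(** The quantity is the average of its analogues on the two halves, each of length (b - a) / 2;
    hence the factor (b - a) / 4. *)
Lemma half_sum_le (R : realType) (a b lambda mu fa fm fb Fm Fb D X Y : R) :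
  a < b ->
  `|lambda * fa + (1 - lambda) * fm - Fm / ((b - a) / 2)| <=
    (b - a) / 2 * (D * X) ->
  `|(1 - mu) * fm + mu * fb - (Fb - Fm) / ((b - a) / 2)| <=
    (b - a) / 2 * (D * Y) ->
  `|(lambda * fa + mu * fb) / 2 + (2 - lambda - mu) / 2 * fm - (b - a)^-1 * Fb|
    <= (b - a) / 4 * D * (X + Y).
Proof.
move=> ab left_half right_half.
have ba0 : b - a != 0 by rewrite gt_eqF// subr_gt0.
have h0 : 0 <= 2^-1 :> R by rewrite invr_ge0.
rewrite (_ : _ - _ = 2^-1 * (lambda * fa + (1 - lambda) * fm
    - Fm / ((b - a) / 2)) + 2^-1 * ((1 - mu) * fm + mu * fb
    - (Fb - Fm) / ((b - a) / 2))); last by field.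
apply: le_trans (ler_normD _ _) _.
rewrite !normrM (ger0_norm h0).
apply: le_trans (lerD (ler_wpM2l h0 left_half) (ler_wpM2l h0 right_half)) _.
by rewrite le_eqVlt; apply/orP; left; apply/eqP; field.
Qed.

(** The factor 2^s is moved under the root and M 2^s replaced by A + B, which is legitimate because
    the weight of M is nonnegative; A then collects both weights. *)
Lemma half_weight_le (R : realType) (q s t A B M : R) :
  1 <= q -> -1 < s -> 0 <= t <= 1 -> 0 <= A -> 0 <= M ->
  M * 2 `^ s <= A + B ->
  ((2 * (1 - t) `^ (s + 2) + (s + 2) * t - 1) * A
   + (2 * t `^ (s + 2) + s + 1 - (s + 2) * t) * M) `^ q^-1
    * (2 `^ s) `^ q^-1 <=
  (((1 - t) `^ (s + 2) * 2 `^ (s + 1) + 2 * t `^ (s + 2)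
    + s + 1 + ((s + 2) * t - 1) * 2 `^ s - (s + 2) * t) * A
   + (2 * t `^ (s + 2) - (s + 2) * t + s + 1) * B) `^ q^-1.
Proof.
move=> q1 s1 t01 A0 M0 MAB; have q0 : 0 < q by lra.
have c0 : 0 <= 2 `^ s :> R := powR_ge0 2 s.
have w1 : 0 <= 2 * t `^ (s + 2) + s + 1 - (s + 2) * t.
  by apply: powR_s2_weight_ge0; lra.
have w0 : 0 <= 2 * (1 - t) `^ (s + 2) + (s + 2) * t - 1.
  by have := @powR_s2_weight_ge0 _ s (1 - t); lra.
have two_s1 : 2 `^ (s + 1) = 2 * 2 `^ s :> R.
  by rewrite powRD ?pnatr_eq0 ?implybT// powRr1// mulrC.
have S0 := addr_ge0 (mulr_ge0 w0 A0) (mulr_ge0 w1 M0).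
rewrite -powRM// two_s1; have ST := ler_wpM2l w1 MAB.
have le_ST := lerD
  (lexx ((2 * (1 - t) `^ (s + 2) + (s + 2) * t - 1) * A * 2 `^ s)) ST.
apply: ge0_ler_powR; rewrite ?nnegrE ?invr_ge0 ?(ltW q0) ?mulr_ge0//.
- apply: le_trans (mulr_ge0 S0 c0) _; rewrite mulrDl -[X in _ + X]mulrA.
  apply: le_trans le_ST _.
  by rewrite le_eqVlt; apply/orP; left; apply/eqP; ring.
- rewrite mulrDl -[X in _ + X]mulrA; apply: le_trans le_ST _.
  by rewrite le_eqVlt; apply/orP; left; apply/eqP; ring.
Qed.

(** Since 2^(s/q + 2) = 4 (2^s)^(1/q), the change of prefactor is exactly the factor absorbed in
    [Tl] and [Tm]. *)
Lemma midpoint_weight_le (R : realType) (h q s D wl wm Sl Sm Tl Tm : R) :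
  0 <= h -> 0 <= D -> 0 <= wl -> 0 <= wm ->
  Sl * (2 `^ s) `^ q^-1 <= Tl -> Sm * (2 `^ s) `^ q^-1 <= Tm ->
  h / 4 * D * (wl * Sl + wm * Sm) <=
  h / 2 `^ (s / q + 2) * D * (wl * Tl + wm * Tm).
Proof.
move=> h0 D0 wl0 wm0 STl STm.
have -> : 2 `^ (s / q + 2) = 4 * (2 `^ s) `^ q^-1 :> R.
  by rewrite powRD ?pnatr_eq0 ?implybT// powRrM (powR_mulrn 2)//; ring.
have k0 : 0 < (2 `^ s : R) `^ q^-1 by apply: powR_gt0; exact: powR_gt0.
set k := (2 `^ s) `^ _ in k0 STl STm *.
have -> : h / (4 * k) * D * (wl * Tl + wm * Tm) =
  h / 4 * D * ((wl * Tl + wm * Tm) / k) by field; rewrite gt_eqF.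
apply: ler_wpM2l; first by rewrite mulr_ge0// divr_ge0.
rewrite ler_pdivlMr// mulrDl -!mulrA.
by apply: lerD; exact: ler_wpM2l.
Qed.

(** * Consequences of s-convexity, and the conclusion *)

Lemma extended_s_convex_segment (R : realType) (s x y : R) (J : set R)
    (g : R -> R) : extended_s_convex s J g -> J x -> J y ->
  {in `]0, 1[, forall u : R,
    g (x + u * (y - x)) <= (1 - u) `^ s * g x + u `^ s * g y}.
Proof.
move=> [_ _ _ _ cvx] Jx Jy u; rewrite in_itv/= => u01.
have := cvx x y (1 - u) Jx Jy; rewrite subKr.
have -> : (1 - u) * x + u * y = x + u * (y - x) by ring.
by apply; lra.
Qed.

(** At u = 1/2 both coefficients equal 2^(-s). *)
Lemma extended_s_convex_midpoint (R : realType) (s x y : R) (J : set R)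
    (g : R -> R) : extended_s_convex s J g -> J x -> J y ->
  g ((x + y) / 2) * 2 `^ s <= g x + g y.
Proof.
move=> cvx Jx Jy.
have h : (2^-1 : R) \in `]0, 1[ by rewrite in_itv/=; lra.
have := extended_s_convex_segment cvx Jx Jy h.
have -> : 1 - 2^-1 = 2^-1 :> R by field.
have -> : x + 2^-1 * (y - x) = (x + y) / 2 by field.
rewrite -mulrDr -[X in X `^ s]powR_inv1// powRAC powR_inv1 ?powR_ge0//.
by rewrite [leRHS]mulrC ler_pdivlMr// powR_gt0.
Qed.

Theorem theorem3p2 (R : realType) (I : set R) (f : R -> R)
    (a b q s lambda mu : R)
    (I_itv : is_interval I) (I_ge0 : forall x, I x -> 0 <= x)
    (df : forall x, I° x -> derivable f x 1)
    (Ia : I a) (Ib : I b) (ab : a < b)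
    (df_ab : forall x, a <= x <= b -> derivable_in I f x)
    (int_df : lebesgue_measure.-integrable `[a, b] (EFin \o derive_in I f))
    (q1 : 1 <= q) (s_gtN1 : -1 < s) (s_le1 : s <= 1)
    (lambda01 : 0 <= lambda <= 1) (mu01 : 0 <= mu <= 1)
    (cvx : extended_s_convex s `[a, b]%classic (fun x => `|derive_in I f x| `^ q)) :
  let m := (a + b) / 2 in
  let g := fun x => `|derive_in I f x| `^ q in
  `| (lambda * f a + mu * f b) / 2 + (2 - lambda - mu) / 2 * f m
     - (b - a)^-1 * \int[lebesgue_measure]_(x in `[a, b]) f x |
  <= (b - a) / 4 * (((s + 1) * (s + 2))^-1) `^ q^-1 *
     ((2^-1 - lambda + lambda ^+ 2) `^ (1 - q^-1) *
        ((2 * (1 - lambda) `^ (s + 2) + (s + 2) * lambda - 1) * g a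
         + (2 * lambda `^ (s + 2) + s + 1 - (s + 2) * lambda) * g m) `^ q^-1
      + (2^-1 - mu + mu ^+ 2) `^ (1 - q^-1) *
        ((2 * mu `^ (s + 2) + s + 1 - (s + 2) * mu) * g m
         + (2 * (1 - mu) `^ (s + 2) + (s + 2) * mu - 1) * g b) `^ q^-1)
  <= (b - a) / 2 `^ (s / q + 2) * (((s + 1) * (s + 2))^-1) `^ q^-1 *
     ((2^-1 - lambda + lambda ^+ 2) `^ (1 - q^-1) *
        (((1 - lambda) `^ (s + 2) * 2 `^ (s + 1) + 2 * lambda `^ (s + 2)
          + s + 1 + ((s + 2) * lambda - 1) * 2 `^ s - (s + 2) * lambda) * g a
         + (2 * lambda `^ (s + 2) - (s + 2) * lambda + s + 1) * g b) `^ q^-1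
      + (2^-1 - mu + mu ^+ 2) `^ (1 - q^-1) *
        ((2 * mu `^ (s + 2) - (s + 2) * mu + s + 1) * g a
         + ((1 - mu) `^ (s + 2) * 2 `^ (s + 1) + 2 * mu `^ (s + 2)
            + ((s + 2) * mu - 1) * 2 `^ s - (s + 2) * mu + s + 1) * g b)
          `^ q^-1).

Proof.
cbv zeta; set m := (a + b) / 2; set g := fun x => `|derive_in I f x| `^ q.
have [_ _ _ g0 _] := cvx.
have abI x : a <= x <= b -> I x by move=> xab; exact: I_itv Ia Ib _ xab.
have cf : {within `[a, b], continuous f}.
  apply: (@within_continuous_derivable_in _ I) => x /=; rewrite in_itv/=.
    exact: abI.
  exact: df_ab.
have f' : {in `]a, b[, forall x : R, is_derive x 1 f (derive_in I f x)}.
  move=> x xab; apply: is_derive_derive_in.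
    exact: (interval_itvoo_interior I_itv Ia Ib).
  by apply: df_ab; rewrite !(itvP xab).
pose F x := \int[lebesgue_measure]_(t in `[a, x]) f t.
have [cF F'] : {within `[a, b], continuous F} /\
  {in `]a, b[, forall x : R, is_derive x 1 F (f x)}.
  exact: continuous_Rintegral_primitive.
have am : a < m by rewrite midf_lt.
have mb : m < b by rewrite midf_lt.
have sub1 : `[a, m] `<=` `[a, b] by apply: subset_itv; rewrite bnd_simp// ltW.
have sub2 : `[m, b] `<=` `[a, b] by apply: subset_itv; rewrite bnd_simp// ltW.
have sub1' : `]a, m[ `<=` `]a, b[ by apply: subset_itv; rewrite bnd_simp// ltW.
have sub2' : `]m, b[ `<=` `]a, b[ by apply: subset_itv; rewrite bnd_simp// ltW.
have aI : `[a, b]%classic a by rewrite /= in_itv/= lexx ltW.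
have bI : `[a, b]%classic b by rewrite /= in_itv/= lexx ltW.
have mI : `[a, b]%classic m by rewrite /= in_itv/= !ltW.
have ga : 0 <= g a := g0 _ aI; have gb : 0 <= g b := g0 _ bI.
have gm : 0 <= g m := g0 _ mI.
(* On [[m, b]] the parameter [mu] weights the right endpoint, so the interval bound is applied with
   t = 1 - mu. *)
have mu01' : 0 <= 1 - mu <= 1.
  by case/andP: mu01 => mu0 mu1; rewrite subr_ge0 mu1 gerBl.
have left_half := @weighted_mean_dist_le_itv R f F (derive_in I f) a m (g a)
  (g m) q s lambda am q1 s_gtN1 lambda01 ga gm (continuous_subspaceW sub1 cf)
  (continuous_subspaceW sub1 cF) (fun x xI => f' x (sub1' x xI))
  (fun x xI => F' x (sub1' x xI)) (extended_s_convex_segment cvx aI mI).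
have right_half := @weighted_mean_dist_le_itv R f F (derive_in I f) m b (g m)
  (g b) q s (1 - mu) mb q1 s_gtN1 mu01' gm gb (continuous_subspaceW sub2 cf)
  (continuous_subspaceW sub2 cF) (fun x xI => f' x (sub2' x xI))
  (fun x xI => F' x (sub2' x xI)) (extended_s_convex_segment cvx mI bI).
have gm2 : g m * 2 `^ s <= g a + g b := extended_s_convex_midpoint cvx aI bI.
have Fa0 : F a = 0 by rewrite /F set_itv1 Rintegral_set1.
have bm : b - m = (b - a) / 2 by rewrite /m; field.
have ma : m - a = (b - a) / 2 by rewrite /m; field.
rewrite Fa0 subr0 ma in left_half; rewrite subKr bm in right_half.
rewrite -/(F b); move: (F b) (F m) (f a) (f b) (f m) left_half right_half.
move: (g a) (g b) (g m) ga gb gm gm2 => A B M A0 B0 M0 MAB.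
move=> Fb Fm fa fb fm left_half right_half.
(* Under mu -> 1 - mu, W is invariant and the two power weights are exchanged. *)
have Wmu : 2^-1 - (1 - mu) + (1 - mu) ^+ 2 = 2^-1 - mu + mu ^+ 2 by field.
have w0 : 2 * mu `^ (s + 2) + (s + 2) * (1 - mu) - 1 =
  2 * mu `^ (s + 2) + s + 1 - (s + 2) * mu by ring.
have w1 : 2 * (1 - mu) `^ (s + 2) + s + 1 - (s + 2) * (1 - mu) =
  2 * (1 - mu) `^ (s + 2) + (s + 2) * mu - 1 by ring.
rewrite Wmu w0 w1 in right_half.
apply/andP; split; first exact: half_sum_le left_half right_half.
apply: midpoint_weight_le; rewrite ?powR_ge0 ?subr_ge0 ?(ltW ab)//.
  exact: half_weight_le.
(* The right half is the mirror image of the left one, with A and B exchanged. *)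
have BA : M * 2 `^ s <= B + A by rewrite addrC.
have := half_weight_le q1 s_gtN1 mu01 B0 M0 BA.
rewrite [X in X `^ _ * _]addrC [X in _ <= X `^ _]addrC.
have -> // : (1 - mu) `^ (s + 2) * 2 `^ (s + 1) + 2 * mu `^ (s + 2) + s + 1 +
    ((s + 2) * mu - 1) * 2 `^ s - (s + 2) * mu =
  (1 - mu) `^ (s + 2) * 2 `^ (s + 1) + 2 * mu `^ (s + 2) +
    ((s + 2) * mu - 1) * 2 `^ s - (s + 2) * mu + s + 1 by ring.
Qed.
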